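(* Let $\ell \geq 1$ and $n$ be integers. If $n \in \mathcal{D}(\ell+1,\ell) \setminus \mathcal{X}(\ell+1,\ell)$, then $\mathcal{Q}_{\ell+1}^{\ell} \,|\, \mathcal{Q}_n^{\ell}$.
   Context: $\mathcal{Q}_n$ denotes the $n$-dimensional hypercube, and $A^k$ the $k$-skeleton of a polytope $A$; $\mathcal{Q}_{\ell+1}^\ell$ is the boundary complex of the $(\ell+1)$-cube. For polytopal $\ell$-complexes $L,K$, $L\,|\,K$ means $K$ and $L$ both have dimension $\ell$ and $K$ is a union of subcomplexes $L_1,\dots,L_r$, each isomorphic to $L$, such that every $\ell$-face of $K$ lies in exactly one $L_i$. A $(v,k,t)$-configuration is a $v$-element set with a family of $k$-element subsets (blocks) such that every $t$-element subset lies in exactly one block. For $1\le t<k$, $\mathcal{D}(k,t) = \{ v \ge k : \binom{k-h}{t-h} \text{ divides } \binom{v-h}{t-h} \text{ for all } 0 \le h \le t-1\}$, and $\mathcal{X}(k,t)$ is the set of $v\in\mathcal{D}(k,t)$ for which no $(v,k,t)$-configuration exists (finite by Keevash's theorem on existence of designs, which the result uses). *)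

(* Defs.v *)
From HB Require Import structures.
From mathcomp Require Import all_boot all_order all_algebra.
From mathcomp Require Import boolp classical_sets functions cardinality reals.

Set Implicit Arguments.
Unset Strict Implicit.
Unset Printing Implicit Defensive.

Import Order.TTheory GRing.Theory Num.Theory.

Local Open Scope classical_set_scope.
Local Open Scope ring_scope.

Definition conv_hull (R : realType) (n : nat) (s : seq 'rV[R]_n) :
    set 'rV[R]_n :=
  [set x | exists w : 'I_(size s) -> R,
    [/\ forall i, 0 <= w i,
        \sum_(i < size s) w i = 1
      & x = \sum_(i < size s) w i *: s`_i]].

(* The empty set is a polytope (s = [::]). *)
Definition polytope (R : realType) (n : nat) (P : set 'rV[R]_n) : Prop :=
  exists s : seq 'rV[R]_n, P = conv_hull s.

(* [x *m c <= b] ranges over the linear inequalities valid on P; set0 and P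
   itself are faces of P (c = 0 with b = 1 and b = 0 respectively). *)
Definition face (R : realType) (n : nat) (F P : set 'rV[R]_n) : Prop :=
  exists (c : 'cV[R]_n) (b : R),
    (forall x, P x -> (x *m c) 0 0 <= b) /\
    F = [set x | P x /\ (x *m c) 0 0 = b].

Definition aff_indep (R : realType) (n m : nat) (p : 'I_m -> 'rV[R]_n) : Prop :=
  forall a : 'I_m -> R,
    \sum_(i < m) a i = 0 -> \sum_(i < m) a i *: p i = 0 -> forall i, a i = 0.

(* Dimension of the affine hull of P: one less than the largest number of
   affinely independent points of P (at most n.+1 in R^n); aff_dim set0 = -1. *)
Definition aff_dim (R : realType) (n : nat) (P : set 'rV[R]_n) : int :=
  (\max_(m < n.+2 | `[< exists p : 'I_m -> 'rV[R]_n,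
                          (forall i, P (p i)) /\ aff_indep p >]) m)%N%:Z - 1.

Definition polytopal_complex (R : realType) (n : nat)
    (K : set (set 'rV[R]_n)) : Prop :=
  [/\ finite_set K,
      (forall P, K P -> polytope P),
      K set0,
      (forall P F, K P -> face F P -> K F)
    & (forall P Q, K P -> K Q -> face (P `&` Q) P /\ face (P `&` Q) Q)].

Definition complex_dim (R : realType) (n : nat) (K : set (set 'rV[R]_n))
    (d : int) : Prop :=
  (exists2 F, K F & aff_dim F = d) /\ (forall F, K F -> aff_dim F <= d).

Definition subcomplex (R : realType) (n : nat) (L K : set (set 'rV[R]_n)) :
    Prop :=
  polytopal_complex L /\ L `<=` K.

(* Combinatorial isomorphism: an isomorphism of the posets of faces. *)
Definition complex_iso (R : realType) (m n : nat)
    (L : set (set 'rV[R]_m)) (K : set (set 'rV[R]_n)) : Prop :=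
  exists f : set 'rV[R]_m -> set 'rV[R]_n,
    set_bij L K f /\
    (forall F G, L F -> L G -> (f F `<=` f G <-> F `<=` G)).

Definition complex_divides (R : realType) (m n : nat)
    (L : set (set 'rV[R]_m)) (K : set (set 'rV[R]_n)) : Prop :=
  [/\ polytopal_complex L,
      polytopal_complex K
    & exists l : nat,
      [/\ complex_dim L l%:Z,
          complex_dim K l%:Z
        & exists (r : nat) (Ls : 'I_r -> set (set 'rV[R]_n)),
          [/\ (forall i, subcomplex (Ls i) K /\ complex_iso L (Ls i)),
              K = \bigcup_(i in [set: 'I_r]) Ls i
            & (forall F, K F -> aff_dim F = l%:Z -> exists! i, Ls i F)]]].

Definition cube (R : realType) (n : nat) : set 'rV[R]_n :=
  [set x | forall i, 0 <= x 0 i <= 1].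

Definition skeleton (R : realType) (n : nat) (A : set 'rV[R]_n) (k : nat) :
    set (set 'rV[R]_n) :=
  [set F | face F A /\ aff_dim F <= k%:Z].

(* Since every t-subset lies in exactly one block and t < k, no block can be
   repeated, so the family of blocks is a set. *)
Definition configuration (T : finType) (k t : nat) (B : {set {set T}}) : Prop :=
  (forall b : {set T}, b \in B -> #|b| = k) /\
  (forall S : {set T}, #|S| = t ->
     exists! b : {set T}, b \in B /\ S \subset b).

Definition configuration_exists (v k t : nat) : Prop :=
  exists (T : finType) (B : {set {set T}}), #|T| = v /\ configuration k t B.

Definition Dset (k t : nat) : set nat :=
  [set v | (k <= v)%N /\
    forall h : nat, (h < t)%N -> ('C(k - h, t - h) %| 'C(v - h, t - h))%N].

Definition Xset (k t : nat) : set nat :=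
  [set v | Dset k t v /\ ~ configuration_exists v k t].

(* Main.v *)
(** Nonempty faces of the n-cube are sign vectors: each coordinate is either
    free or fixed to 0 or 1. For every block b of an (n, l+1, l)-configuration
    on the coordinates and every 0/1 assignment A of the coordinates outside b,
    take the boundary of the (l+1)-face with free coordinates b and fixed
    coordinates A. An l-face has l free coordinates; these lie in a unique block
    b, and its fixed coordinates outside b then determine A. A face of smaller
    dimension lies in some piece because its free coordinates extend to an
    l-subset, hence to a block. *)
Require Import Defs.
From mathcomp Require Import all_boot all_order all_algebra.
From mathcomp Require Import boolp classical_sets functions cardinality reals.
From mathcomp Require Import lra.

Set Implicit Arguments.
Unset Strict Implicit.
Unset Printing Implicit Defensive.

Import Order.TTheory GRing.Theory Num.Theory.

Local Open Scope classical_set_scope.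
Local Open Scope ring_scope.

(** * Sign vectors and the cells they describe *)

(* [None] marks a free coordinate. *)
Definition side (R : realType) (o : option bool) : set R :=
  if o is Some b then [set b%:R] else [set t | 0 <= t <= 1].

Definition cell (R : realType) (n : nat) (s : {ffun 'I_n -> option bool}) :
    set 'rV[R]_n :=
  [set x | forall i, side (s i) (x 0 i)].

(** The face order on sign vectors: the first argument fixes more coordinates, so it is the smaller
    face. *)
Definition refines (n : nat) (t s : {ffun 'I_n -> option bool}) : Prop :=
  forall i b, s i = Some b -> t i = Some b.

Definition free (n : nat) (s : {ffun 'I_n -> option bool}) : {set 'I_n} :=
  [set i | s i == None]%SET.

(** The empty face is added separately because no sign vector describes it. *)
Definition cells (R : realType) (n : nat)
    (S : {ffun 'I_n -> option bool} -> Prop) : set (set 'rV[R]_n) :=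
  [set F | F = set0 \/ exists2 s, S s & F = cell s].
Arguments cells R {n} S.

Section Cells.
Variables (R : realType) (n : nat).
Implicit Types (s t : {ffun 'I_n -> option bool}) (A : {set 'I_n}).
Implicit Types (x : 'rV[R]_n).

Lemma refines_free t s : refines t s -> free t \subset free s.
Proof.
move=> ts; apply/fintype.subsetP => i; rewrite !inE.
by case E: (s i) => [b|//]; rewrite (ts _ _ E).
Qed.

(** Only the part of [A] inside [free s] matters, so all subsets of the coordinates index the
    vertices of any cell, with repetitions. *)
Definition vertex s A : 'rV[R]_n :=
  \row_i (if s i is Some b then b%:R else (i \in A)%:R).

Lemma side_bool (b : bool) : side None (b%:R : R).
Proof. by case: b => /=; lra. Qed.

Lemma side01 o (z : R) : side o z -> 0 <= z <= 1.
Proof. by case: o => [b ->|//]; exact: side_bool. Qed.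

Lemma vertex_cell s A : cell s (vertex s A).
Proof.
move=> i; rewrite mxE; case: (s i) => [b|]; [by [] | exact: side_bool].
Qed.

Lemma cell_subset t s : (cell t : set 'rV[R]_n) `<=` cell s <-> refines t s.
Proof.
split=> [ts i b si|ts x xt i].
  have h A : vertex t A 0 i = b%:R :> R.
    by have := ts _ (vertex_cell t A) i; rewrite si.
  (* The vertices with all free coordinates 1 and all 0 would differ at a coordinate left free by
     [t]. *)
  have := h finset.setT; have := h finset.set0; rewrite !mxE !inE.
  case: (t i) => [b'|] /=.
    by move=> /eqP; rewrite eqr_nat; case: b b' {h si} => -[].
  by case: b {h si} => /= h0 h1; exfalso; lra.
have := xt i; case E: (s i) => [b|].
  by rewrite (ts _ _ E).
by move/side01.
Qed.

Lemma cell_inj : injective (@cell R n).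
Proof.
move=> s t E; apply/ffunP => i.
have st : refines s t by apply/cell_subset; rewrite E.
have ts : refines t s by apply/cell_subset; rewrite E.
case Es: (s i) => [b|]; first by rewrite (ts _ _ Es).
by case Et: (t i) => [b|//]; rewrite -Es (st _ _ Et).
Qed.

Lemma cell_neq0 s : cell s <> set0 :> set 'rV[R]_n.
Proof.
by move=> E; have := vertex_cell s finset.set0; rewrite E.
Qed.

Lemma cube_cell : @cube R n = cell [ffun=> None].
Proof.
by apply/seteqP; split=> x xc i; have := xc i; rewrite ffunE.
Qed.

(** * Faces of a cell *)

Lemma dot_sum x (c : 'cV[R]_n) : (x *m c) 0 0 = \sum_i x 0 i * c i 0.
Proof. by rewrite mxE. Qed.

Lemma set0_face (P : set 'rV[R]_n) : face set0 P.
Proof.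
exists 0, 1; split=> [x _|]; first by rewrite mulmx0 mxE; lra.
by apply/seteqP; split=> x //= -[_]; rewrite mulmx0 mxE; lra.
Qed.

(* A linear functional c is maximised on a cell at the vertex that takes
   coordinate 1 exactly where c is positive, and its level set there fixes
   precisely the coordinates where c does not vanish. *)
Lemma face_cell_refines (F : set 'rV[R]_n) s :
  face F (cell s) -> F = set0 \/ exists2 t, refines t s & F = cell t.
Proof.
move=> [c [b [cb ->]]].
pose v := vertex s [set i | 0 < c i 0]%SET.
have vs : cell s v by exact: vertex_cell.
have le x i : cell s x -> x 0 i * c i 0 <= v 0 i * c i 0.
  move=> /(_ i); rewrite mxE; case: (s i) => [b'->//|] /= x01.
  by rewrite inE; case: (ltP 0 (c i 0)) => ci /=; nra.
case: (pselect (exists x, cell s x /\ (x *m c) 0 0 = b)) => [[y [ys yb]]|no];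
  last first.
  by left; apply/seteqP; split=> x //= xF; apply: no; exists x.
right.
(* The bound [b] is attained at [y], and [v] dominates [y] term by term, so [v] attains it too. *)
have bE : b = \sum_i v 0 i * c i 0.
  apply: le_anti; rewrite -{2}dot_sum (cb _ vs) andbT -yb dot_sum.
  by apply: ler_sum => i _; exact: le.
pose t : {ffun 'I_n -> option bool} := [ffun i =>
  if s i is Some b' then Some b' else
  if c i 0 == 0 then None else Some (0 < c i 0)].
exists t.
  by move=> i b' si; rewrite ffunE si.
have key x i : cell s x -> (x 0 i * c i 0 = v 0 i * c i 0) <-> side (t i) (x 0 i).
  move=> /(_ i); rewrite mxE ffunE; case: (s i) => [b' /= ->//|x01].
  rewrite inE; case: eqP => [->|/eqP ci]; first by rewrite !mulr0.
  by split=> [/(mulIf ci)//|/= ->].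
apply/seteqP; split=> [x [xs xb] i|x xt].
  apply/(key x i xs).
  (* The gaps between the terms of [v] and [x] are nonnegative with sum zero, so each vanishes. *)
  have /eqP := etrans (esym bE) (esym xb); rewrite dot_sum -subr_eq0 -sumrB.
  rewrite psumr_eq0 => [/allP/(_ i)|j _]; last by rewrite subr_ge0 le.
  by rewrite mem_index_enum => /(_ isT); rewrite subr_eq0 => /eqP.
have xs : cell s x.
  have : (cell t : set 'rV[R]_n) `<=` cell s.
    by apply/cell_subset => i b' si; rewrite ffunE si.
  exact.
by split=> //; rewrite dot_sum bE; apply: eq_bigr => i _; apply/key.
Qed.

(** Weight 1 on coordinates that [t] fixes to 1, -1 on those fixed to 0 and 0 on the free ones gives
    a functional whose maximum over the larger cell is attained exactly on the smaller. *)
Lemma refines_face_cell t s : refines t s -> face (cell t : set 'rV[R]_n) (cell s).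
Proof.
move=> ts.
pose c : 'cV[R]_n := \col_i (if t i is Some b then if b then 1 else -1 else 0).
pose d i : R := if t i is Some true then 1 else 0.
have le x i : cell s x -> x 0 i * c i 0 <= d i.
  move=> /(_ i) /side01; rewrite mxE /d.
  by case: (t i) => [[]|]; rewrite ?mulr1 ?mulr0 ?mulrN1; lra.
exists c, (\sum_i d i); split=> [x xs|].
  by rewrite dot_sum; apply: ler_sum => i _; exact: le.
apply/seteqP; split=> [x xt|x [xs xd] i].
  split; first by have /cell_subset := ts; apply.
  rewrite dot_sum; apply: eq_bigr => i _; have := xt i; rewrite mxE /d.
  by case: (t i) => [[]|] /=; rewrite ?mulr0 // => ->; lra.
have /eqP := esym xd; rewrite dot_sum -subr_eq0 -sumrB psumr_eq0; last first.
  by move=> j _; rewrite subr_ge0 le.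
move=> /allP /(_ i); rewrite mem_index_enum => /(_ isT); rewrite mxE /d.
have := side01 (xs i).
by case: (t i) => [[]|] //= x01 /eqP; rewrite ?mulr1 ?mulrN1; lra.
Qed.

Lemma face_cellE (F : set 'rV[R]_n) s :
  face F (cell s) <-> F = set0 \/ exists2 t, refines t s & F = cell t.
Proof.
split; first exact: face_cell_refines.
by move=> [->|[t ts ->]]; [exact: set0_face | exact: refines_face_cell].
Qed.

(** * Complexes made of cells *)

(** Opposite fixed values at some coordinate make the cells disjoint; otherwise [u] fixes every
    coordinate that [s] or [t] fixes. *)
Lemma cell_setI s t :
  cell s `&` cell t = set0 :> set 'rV[R]_n \/
  exists u, [/\ refines u s, refines u t
    & cell s `&` cell t = cell u :> set 'rV[R]_n].
Proof.
case: (pselect (exists i b, s i = Some b /\ t i = Some (~~ b))).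
  move=> [i [b [si ti]]]; left; apply/seteqP; split=> x //= -[/(_ i) xs /(_ i)].
  by move: xs; rewrite si ti /= => ->; case: b {si ti} => /=; lra.
move=> no; right.
pose u : {ffun 'I_n -> option bool} :=
  [ffun i => if s i is Some b then Some b else t i].
have us : refines u s by move=> i b si; rewrite ffunE si.
have ut : refines u t.
  move=> i b ti; rewrite ffunE; case si: (s i) => [b'|//]; congr Some.
  apply/eqP; apply: contra_notT no => h.
  by exists i, b'; split=> //; rewrite ti; case: b b' h {ti si} => -[].
exists u; split=> //; apply/seteqP; split=> [x [xs xt] i|x xu].
  by rewrite ffunE; have := xs i; case: (s i) => [b //|_]; exact: xt.
by split; [have /cell_subset := us | have /cell_subset := ut]; apply.
Qed.

(* The barycentric coordinates of x with respect to the vertices of the cube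
   are the products of the x_i (i in A) and the 1 - x_i (i not in A). *)
Lemma cell_polytope s : polytope (cell s : set 'rV[R]_n).
Proof.
pose e := index_enum {set 'I_n}.
exists [seq vertex s A | A <- e].
apply/seteqP; split=> [x xs|x [w [w0 w1 ->]]].
  pose W A : R := \prod_i (if i \in A then x 0 i else 1 - x 0 i).
  have W1 : \sum_A W A = 1.
    by rewrite -bigA_distr; apply: big1 => i _; rewrite /= addrC subrK.
  have Wj j : \sum_A W A * (j \in A)%:R = x 0 j.
    (* The indicator of [j \in A] deletes the summand [1 - x 0 j]; every other factor of the product
       is 1. *)
    transitivity (\prod_i (x 0 i + (if i == j then 0 else 1 - x 0 i))).
      rewrite bigA_distr; apply: eq_bigr => A _.
      case jA: (j \in A); rewrite ?mulr1 ?mulr0 /=.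
        by apply: eq_bigr => i _; case: (eqVneq i j) => [->|//]; rewrite jA.
      by rewrite (bigD1 j) //= jA eqxx mul0r.
    rewrite (bigD1 j) //= eqxx addr0 big1 ?mulr1 // => i /negbTE ->.
    by rewrite addrC subrK.
  exists (fun i => W (nth finset.set0 e i)); split.
  - move=> i; apply: prodr_ge0 => j _.
    by have := side01 (xs j); case: ifP => _; lra.
  - rewrite size_map -W1 [RHS](big_nth finset.set0) big_mkord.
    by apply: eq_bigr.
  - transitivity (\sum_A W A *: vertex s A).
      apply/rowP => j; rewrite summxE.
      under eq_bigr do rewrite !mxE.
      have := xs j; case: (s j) => [b ->|_]; last by rewrite Wj.
      by rewrite -mulr_suml W1 mul1r.
    rewrite (big_nth finset.set0) big_mkord size_map.
    apply: eq_bigr => i _; rewrite (nth_map finset.set0) //.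
move=> j; rewrite summxE; under eq_bigr do rewrite mxE.
have vc i : (i < size [seq vertex s A | A <- e])%N ->
    side (s j) ([seq vertex s A | A <- e]`_i 0 j).
  by rewrite size_map => ie; rewrite (nth_map finset.set0) //; exact: vertex_cell.
case E: (s j) => [b|] /=.
  under eq_bigr => i _.
    by have := vc i (ltn_ord i); rewrite E /= => ->; over.
  by rewrite -mulr_suml w1 mul1r.
apply/andP; split.
  apply: sumr_ge0 => i _; apply: mulr_ge0 => //.
  by have /side01 /andP[] := vc i (ltn_ord i).
rewrite -w1; apply: ler_sum => i _; rewrite ler_piMr //.
by have /side01 /andP[] := vc i (ltn_ord i).
Qed.

Lemma set0_polytope : polytope (set0 : set 'rV[R]_n).
Proof.
exists [::]; apply/seteqP; split=> x //= -[w [_ + _]].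
by rewrite big_ord0; lra.
Qed.

Lemma cells_complex (S : {ffun 'I_n -> option bool} -> Prop) :
  (forall s t, S s -> refines t s -> S t) -> polytopal_complex (cells R S).
Proof.
move=> down; split.
- apply: (@sub_finite_set _ _ ([set set0] `|` range (@cell R n))).
    by move=> F [->|[s _ ->]]; [left | right; exists s].
  by rewrite finite_setU; split; [exact: finite_set1 | exact: finite_image].
- by move=> P [->|[s _ ->]]; [exact: set0_polytope | exact: cell_polytope].
- by left.
- move=> P F [->|[s Ss ->]].
    by move=> [c [b [_ ->]]]; left; apply/seteqP; split=> x //= -[].
  by move=> /face_cellE [->|[t ts ->]]; [left | right; exists t => //; exact: down ts].
- move=> P Q [->|[s _ ->]] [->|[t _ ->]]; rewrite ?set0I ?setI0;
    try by split; exact: set0_face.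
  case: (cell_setI s t) => [->|[u [us ut ->]]]; first by split; exact: set0_face.
  by split; apply/face_cellE; right; exists u.
Qed.

(** * Affine dimension of a cell *)

(** Record each point as a row: a leading 1, then its free coordinates. A linear relation between
    rows is an affine relation between points, since fixed coordinates are constant on the cell;
    hence the rows are independent. *)
Lemma aff_indep_cell_le m (p : 'I_m -> 'rV[R]_n) s :
  (forall i, cell s (p i)) -> aff_indep p -> (m <= #|free s|.+1)%N.
Proof.
move=> ps ip.
pose A : 'M[R]_(m, 1 + #|free s|) :=
  \matrix_(i, j) match fintype.split j with
                 | inl _ => 1
                 | inr k => p i 0 (enum_val k)
                 end.
suff : row_free A by rewrite /row_free => /eqP <-; exact: rank_leq_col.
apply: inj_row_free => a aA.
have a1 : \sum_i a 0 i = 0.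
  have /rowP/(_ (lshift _ 0)) := aA; rewrite !mxE => E.
  by rewrite -[RHS]E; apply: eq_bigr => i _; rewrite !mxE (unsplitK (inl 0)) mulr1.
apply/rowP => i; rewrite mxE; apply: (ip (fun i => a 0 i)) => //.
apply/rowP => j; rewrite summxE mxE.
under eq_bigr do rewrite mxE.
case: (boolP (j \in free s)) => [js|].
  have /rowP/(_ (rshift _ (enum_rank_in js j))) := aA; rewrite !mxE => E.
  rewrite -[RHS]E; apply: eq_bigr => k _.
  by rewrite !mxE (unsplitK (inr _)) enum_rankK_in.
rewrite inE; case E: (s j) => [b|//] _.
under eq_bigr => k _.
  by have := ps k j; rewrite E /= => ->; over.
by rewrite -mulr_suml a1 mul0r.
Qed.

(** The vertex with all free coordinates 0 and its neighbours along the free directions span a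
    simplex. *)
Lemma cell_aff_indep s : exists p : 'I_#|free s|.+1 -> 'rV[R]_n,
  (forall i, cell s (p i)) /\ aff_indep p.
Proof.
pose p (i : 'I_#|free s|.+1) : 'rV[R]_n :=
  vertex s (if unlift ord0 i is Some k then [set enum_val k]%SET else finset.set0).
exists p; split=> [i|a a0 ap]; first exact: vertex_cell.
have alift k : a (lift ord0 k) = 0.
  have /rowP/(_ (enum_val k)) := ap; rewrite summxE mxE.
  have := enum_valP k; rewrite inE => /eqP sk.
  rewrite big_ord_recl !mxE sk unlift_none inE mulr0 add0r (bigD1 k) //=.
  rewrite !mxE sk liftK inE eqxx mulr1 big1 ?addr0 // => i ik.
  by rewrite !mxE sk liftK inE (inj_eq enum_val_inj) eq_sym (negbTE ik) mulr0.
move=> i; case: (unliftP ord0 i) => [k ->//|->].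
by move: a0; rewrite big_ord_recl big1 ?addr0.
Qed.

Lemma aff_dim_cell s : aff_dim (cell s : set 'rV[R]_n) = #|free s|%:Z.
Proof.
rewrite /aff_dim.
suff -> : (\max_(m < n.+2 | `[< exists p : 'I_m -> 'rV[R]_n,
    (forall i, cell s (p i)) /\ aff_indep p >]) m)%N = #|free s|.+1.
  by rewrite -addn1 PoszD addrK.
apply/eqP; rewrite eqn_leq; apply/andP; split.
  by apply/bigmax_leqP => m /asboolP [p [ps ip]]; exact: aff_indep_cell_le ip.
(* The size of the simplex must lie in the range of the maximum defining [aff_dim]. *)
have lt : (#|free s|.+1 < n.+2)%N.
  by rewrite !ltnS -[leqRHS](card_ord n) max_card.
apply: (@leq_bigmax_cond _ _ _ (Ordinal lt)).
by apply/asboolP; exact: cell_aff_indep.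
Qed.

Lemma aff_dim_set0 : aff_dim (set0 : set 'rV[R]_n) = -1.
Proof.
rewrite /aff_dim big1 // => m /asboolP [p [p0 _]].
by case: m p p0 => -[|m] lt p p0 //=; case: (p0 ord0).
Qed.

(** * Skeleta of the cube *)

Lemma skeleton_cubeE k :
  skeleton (@cube R n) k =
  cells R (fun s : {ffun 'I_n -> option bool} => #|free s| <= k)%N.
Proof.
apply/seteqP; split=> F.
  move=> [+ dF]; rewrite cube_cell => /face_cellE [->|[t _ FE]]; first by left.
  by right; exists t => //; move: dF; rewrite FE aff_dim_cell.
move=> [->|[s sk ->]]; split.
- exact: set0_face.
- by rewrite aff_dim_set0.
- by rewrite cube_cell; apply/face_cellE; right; exists s => // i b; rewrite ffunE.
- by rewrite aff_dim_cell.
Qed.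

Lemma skeleton_cube_complex k : polytopal_complex (skeleton (@cube R n) k).
Proof.
rewrite skeleton_cubeE; apply: cells_complex => s t sk /refines_free /subset_leq_card.
by move=> h; exact: leq_trans sk.
Qed.

Lemma exists_superset_card A k : (#|A| <= k <= n)%N ->
  exists2 S : {set 'I_n}, A \subset S & #|S| = k.
Proof.
move=> /andP[Ak kn]; have [d kE] : exists d, (k = #|A| + d)%N.
  by exists (k - #|A|)%N; rewrite subnKC.
elim: d A kE {Ak} => [|d IH] A kE; first by exists A; rewrite ?kE ?addn0.
have /card_gt0P [i] : (0 < #|~: A|)%N.
  by rewrite cardsCs finset.setCK card_ord subn_gt0 (leq_trans _ kn) // kE addnS ltnS leq_addr.
rewrite inE => iA.
have [|S] := IH (i |: A)%SET; first by rewrite cardsU1 iA kE addnS.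
by rewrite finset.subUset => /andP[_ AS] Sk; exists S.
Qed.

Lemma skeleton_cube_dim k : (k <= n)%N ->
  complex_dim (skeleton (@cube R n) k) k%:Z.
Proof.
move=> kn; split; last by move=> F [].
have [|S _ Sk] := @exists_superset_card finset.set0 k; first by rewrite cards0.
pose s : {ffun 'I_n -> option bool} :=
  [ffun i => if i \in S then None else Some false].
have fs : free s = S.
  by apply/setP => i; rewrite !inE ffunE; case: (i \in S).
exists (cell s); last by rewrite aff_dim_cell fs Sk.
by rewrite skeleton_cubeE; right; exists s => //; rewrite fs Sk.
Qed.

End Cells.

(** * Embedding a cube as a face of a larger cube *)

Section Embedding.
Variables (R : realType) (k n : nat) (e : 'I_k -> 'I_n) (A : {set 'I_n}).
Hypothesis e_inj : injective e.

(** The image of [e] gives the free coordinates of the target face; [A] fixes the values of the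
    others. *)
Definition embed_point (x : 'rV[R]_k) : 'rV[R]_n :=
  \row_i (if [pick j | e j == i] is Some j then x 0 j else (i \in A)%:R).

Definition embed_cell (s : {ffun 'I_k -> option bool}) :
    {ffun 'I_n -> option bool} :=
  [ffun i => if [pick j | e j == i] is Some j then s j else Some (i \in A)].

Lemma pick_image j : [pick j' | e j' == e j] = Some j.
Proof.
by case: pickP => [j' /eqP /e_inj ->//|/(_ j)]; rewrite eqxx.
Qed.

Lemma embed_point_inj : injective embed_point.
Proof.
by move=> x y /rowP xy; apply/rowP => j; have := xy (e j); rewrite !mxE pick_image.
Qed.

Lemma embed_point_cell s : embed_point @` cell s = cell (embed_cell s).
Proof.
apply/seteqP; split=> [_ [x xs <-] i|y ys].
  by rewrite mxE ffunE; case: pickP.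
exists (\row_j y 0 (e j)) => [j|].
  by have := ys (e j); rewrite mxE ffunE pick_image.
apply/rowP => i; rewrite mxE; have := ys i; rewrite ffunE.
by case: pickP => [j /eqP <-|_ ->//]; rewrite mxE.
Qed.

Lemma card_free_embed s : #|free (embed_cell s)| = #|free s|.
Proof.
rewrite -(card_imset _ e_inj); congr #|pred_of_set _|; apply/setP => i.
rewrite !inE ffunE; apply/idP/imsetP.
  by case: pickP => // j /eqP <- sj; exists j; rewrite ?inE.
by move=> [j + ->]; rewrite inE pick_image.
Qed.

End Embedding.

(** * Boundaries of faces as copies of a skeleton *)

(* The boundary of the face of the cube with free coordinates b whose fixed
   coordinates take the value 1 exactly on A. *)
Definition boundary (n l : nat) (b A : {set 'I_n})
    (s : {ffun 'I_n -> option bool}) : Prop :=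
  (#|free s| <= l)%N /\ forall i, i \notin b -> s i = Some (i \in A).

Lemma boundary_refines (n l : nat) (b A : {set 'I_n}) s t :
  boundary l b A s -> refines t s -> boundary l b A t.
Proof.
move=> [sl sA] ts; split; last by move=> i /sA /ts.
exact: leq_trans (subset_leq_card (refines_free ts)) sl.
Qed.

Lemma free_boundary (n l : nat) (b A : {set 'I_n}) s :
  boundary l b A s -> free s \subset b.
Proof.
move=> [_ sA]; apply/fintype.subsetP => i; rewrite inE => /eqP si.
by apply: contraT => /sA; rewrite si.
Qed.

Lemma injection_onto (T : finType) (b : {set T}) k : #|b| = k ->
  exists e : 'I_k -> T, injective e /\ b = (e @: finset.setT)%SET.
Proof.
move=> <-; exists enum_val; split; first exact: enum_val_inj.
apply/setP => i; apply/idP/imsetP => [ib|[j _ ->]]; last exact: enum_valP.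
by exists (enum_rank_in ib i); rewrite ?inE ?enum_rankK_in.
Qed.

(** Direct image under the embedding is the isomorphism; injectivity on points makes it reflect
    inclusion. *)
Lemma boundary_iso (R : realType) (n k l : nat) (b A : {set 'I_n}) :
  #|b| = k ->
  complex_iso (skeleton (@cube R k) l) (cells R (boundary l b A)).
Proof.
move=> /injection_onto [e [e_inj bE]]; rewrite skeleton_cubeE.
have g_inj := @embed_point_inj R _ _ e A e_inj.
have g_sub (F G : set 'rV[R]_k) : embed_point e A @` F `<=` embed_point e A @` G -> F `<=` G.
  move=> FG x Fx; have [|y Gy /g_inj <-//] := FG (embed_point e A x).
  by exists x.
exists (image^~ (@embed_point R _ _ e A)); split; first split.
- move=> F [->|[s sl ->]]; first by left; rewrite image_set0.
  right; rewrite embed_point_cell //; exists (embed_cell e A s) => //.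
  split=> [|i ib]; first by rewrite card_free_embed.
  rewrite ffunE; case: pickP => // j /eqP ji.
  by case/negP: ib; rewrite bE -ji imset_f // inE.
- by move=> F G _ _ FG; apply/seteqP; split; apply: g_sub; rewrite FG.
- move=> F [->|[t [tl tA] ->]]; first by exists set0; [left | rewrite image_set0].
  (* Restricting [t] to [b] loses nothing: outside [b] its values are prescribed by [A]. *)
  pose s : {ffun 'I_k -> option bool} := [ffun j => t (e j)].
  have tE : embed_cell e A s = t.
    apply/ffunP => i; rewrite ffunE; case: pickP => [j /eqP <-|no].
      by rewrite ffunE.
    rewrite tA // bE; apply/imsetP => -[j _ ij].
    by have := no j; rewrite ij eqxx.
  exists (cell s); last by rewrite embed_point_cell // tE.
  by right; exists s => //; rewrite -(card_free_embed A e_inj) tE.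
- by move=> F G _ _; split; [exact: g_sub | exact: image_subset].
Qed.

(** * Configurations on the coordinate set *)

Lemma configuration_ord (v k t : nat) : configuration_exists v k t ->
  exists B : {set {set 'I_v}}, configuration k t B.
Proof.
move=> [T [B [<- [Bk Bt]]]].
exists [set (enum_rank @: (b : {set T}))%SET | b in B]%SET; split.
  by move=> _ /imsetP [b /Bk bk ->]; rewrite card_imset //; exact: enum_rank_inj.
move=> S St; have [|b [[bB Sb] bU]] := Bt (enum_val @: S)%SET.
  by rewrite card_imset //; exact: enum_val_inj.
have sub (c : {set T}) :
    (S \subset enum_rank @: c) = (enum_val @: S \subset c).
  apply/fintype.subsetP/fintype.subsetP => [h _ /imsetP [i /h /imsetP [j jc ->] ->]|h i iS].
    by rewrite enum_rankK.
  by rewrite -(enum_valK i); apply: imset_f; apply: h; exact: imset_f.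
exists (enum_rank @: b)%SET; split.
  by split; [exact: imset_f | rewrite sub].
move=> _ [/imsetP [c cB ->]]; rewrite sub => Sc.
by rewrite (bU c).
Qed.

(** * Decomposition of the skeleton into boundaries of faces *)

Theorem theorem3 (R : realType) (l n : nat) (hl : (1 <= l)%N)
    (hn : (Dset l.+1 l `\` Xset l.+1 l) n) :
  complex_divides (skeleton (@cube R l.+1) l) (skeleton (@cube R n) l).
Proof.
have [Dn Xn] := hn; have [ln _] := Dn.
have /configuration_ord [B [Bk Bt]] : configuration_exists n l.+1 l.
  by apply: contrapT => no; apply: Xn.
split; [exact: skeleton_cube_complex | exact: skeleton_cube_complex |].
exists l; split; [exact: skeleton_cube_dim | exact: skeleton_cube_dim (ltnW ln) |].
(* Keeping [A] outside [b] ensures that distinct pairs give distinct fixed values, as uniqueness of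
   the piece requires. *)
pose P := [set p : {set 'I_n} * {set 'I_n} |
  (p.1 \in B) && (p.2 \subset ~: p.1)]%SET.
pose bA (i : 'I_#|P|) := enum_val i.
have indexP (b A : {set 'I_n}) : b \in B -> A \subset ~: b -> exists i, bA i = (b, A).
  move=> bB Ab; have pP : (b, A) \in P by rewrite inE bB.
  by exists (enum_rank_in pP (b, A)); exact: enum_rankK_in.
have bAP i : ((bA i).1 \in B) /\ ((bA i).2 \subset ~: (bA i).1).
  by have := enum_valP i; rewrite inE => /andP[].
pose Ls i := cells R (boundary l (bA i).1 (bA i).2).
have LsK i : Ls i `<=` skeleton (@cube R n) l.
  rewrite skeleton_cubeE => F [->|[s [sl _] ->]]; first by left.
  by right; exists s.
have cover (s : {ffun 'I_n -> option bool}) : (#|free s| <= l)%N ->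
    exists i, boundary l (bA i).1 (bA i).2 s.
  move=> sl; have [|S sS Sl] := @exists_superset_card n (free s) l.
    by rewrite sl ltnW.
  have [b [[bB Sb] _]] := Bt _ Sl.
  (* [A] is read off from the 1-coordinates of [s] outside [b]; all coordinates there are fixed
     because [b] contains the free ones. *)
  have [||i iE] := indexP b [set i in ~: b | s i == Some true]%SET => //.
    by apply/fintype.subsetP => i; rewrite inE => /andP[].
  exists i; rewrite iE; split=> //= j jb; rewrite !inE jb /=.
  case E: (s j) => [[]|] //.
  case/negP: jb; apply: (fintype.subsetP Sb); apply: (fintype.subsetP sS).
  by rewrite inE E.
exists #|P|, Ls; split.
- move=> i; have [iB _] := bAP i; split; last by apply: boundary_iso; exact: Bk.
  split; last exact: LsK.
  by apply: cells_complex => s t; exact: boundary_refines.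
- apply/seteqP; split=> [F|F [i _]]; last exact: LsK.
  rewrite skeleton_cubeE => -[->|[s sl ->]].
    (* The empty face lies in every piece, so one piece must exist; a vertex supplies it. *)
    have [|i _] := cover [ffun=> Some false].
      rewrite (_ : free _ = finset.set0) ?cards0 //.
      by apply/setP => i; rewrite !inE ffunE.
    by exists i => //; left.
  by have [i si] := cover s sl; exists i => //; right; exists s.
- rewrite skeleton_cubeE => F [->|[s sl ->]].
    (* The empty face has dimension -1 and is never an [l]-face. *)
    by rewrite aff_dim_set0.
  rewrite aff_dim_cell => -[sE].
  have [i si] := cover s sl; exists i; split; first by right; exists s.
  move=> j [/cell_neq0 //|[t sj /cell_inj st]]; rewrite -{t}st in sj.
  have [iB iA] := bAP i; have [jB jA] := bAP j.
  (* Both blocks contain the [l]-set [free s], hence coincide. *)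
  have bE : (bA i).1 = (bA j).1.
    have [b [_ bU]] := Bt _ sE.
    transitivity b; first by apply/esym/bU; split=> //; exact: free_boundary si.
    by apply: bU; split=> //; exact: free_boundary sj.
  suff AE : (bA i).2 = (bA j).2.
    apply: enum_val_inj; move: bE AE; rewrite /bA.
    by case: enum_val => ? ?; case: enum_val => ? ? /= -> ->.
  (* On the common block neither set has elements; off it both are given by the values of [s]. *)
  apply/setP => x; case: (boolP (x \in (bA i).1)) => xb.
    have notin (b A : {set 'I_n}) : A \subset ~: b -> x \in b -> (x \in A) = false.
      by move=> /fintype.subsetP Ab; apply: contraTF => /Ab; rewrite inE.
    by rewrite (notin _ _ iA) // (notin _ _ jA) // -bE.
  have [_ /(_ x xb)] := si; have [_ /(_ x)] := sj.
  by rewrite -bE => /(_ xb) -> [->].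
Qed.
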